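(* $\Delta(\mathcal{K}_{1}^{5})\leq 2$, i.e., $s(\mathcal{K}_{1}^{5})\geq 24$.
   Context: Real universal complex: for $n\ge 1$, $\mathcal{K}_{1}^{n}$ is the simplicial complex whose vertices are the primitive (i.e. nonzero) vectors of $\mathbb{Z}_2^n$ (where $\mathbb{Z}_2=\mathbb{Z}/2$), so it has $2^n-1$ vertices, and in which a set of vertices $\{v_1,\dots,v_k\}$ is a simplex if and only if it is part of a basis of $\mathbb{Z}_2^n$. Moment-angle complexes: let $K$ be a simplicial complex on $[m]=\{1,\dots,m\}$. For a pair $A\subseteq X$ and $I\subseteq[m]$ put $(X,A)^I=\{(x_1,\dots,x_m)\in X^m : x_i\in A \text{ if } i\notin I\}$. Let $D^1=[-1,1]$, $S^0=\{-1,1\}$, $D^2=\{z\in\mathbb{C}:|z|\le 1\}$, $S^1=\partial D^2$. Define $\mathbb{R}\mathcal{Z}_K=\bigcup_{I\in K}(D^1,S^0)^I\subseteq (D^1)^m$ and $\mathcal{Z}_K=\bigcup_{I\in K}(D^2,S^1)^I\subseteq (D^2)^m$. The group $\mathbb{Z}_2^m$ acts on $\mathbb{R}\mathcal{Z}_K$ by coordinatewise sign changes, and the torus $T^m=(S^1)^m$ acts on $\mathcal{Z}_K$ by coordinatewise rotation. Buchstaber invariants: the real Buchstaber invariant $s_{\mathbb{R}}(K)$ is the maximal rank of a subgroup $H\subseteq\mathbb{Z}_2^m$ whose restricted action on $\mathbb{R}\mathcal{Z}_K$ is free. The Buchstaber invariant $s(K)$ is the maximal rank of a toric subgroup $G\subseteq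 T^m$ (a closed subgroup isomorphic to a torus $T^r$; its rank is $r$) whose restricted action on $\mathcal{Z}_K$ is free. Put $\Delta(K)=s_{\mathbb{R}}(K)-s(K)$. It is known that $s_{\mathbb{R}}(\mathcal{K}_1^n)=2^n-1-n$, so $s(\mathcal{K}_1^n)+\Delta(\mathcal{K}_1^n)=2^n-1-n$. *)

(* Defs.v *)
From HB Require Import structures.
From mathcomp Require Import all_boot all_order all_algebra.
From mathcomp Require Import all_fingroup all_solvable complex.
From mathcomp Require Import all_classical all_reals all_analysis.

Set Implicit Arguments.
Unset Strict Implicit.
Unset Printing Implicit Defensive.

Import Order.TTheory GRing.Theory Num.Theory.
Import numFieldNormedType.Exports.

Local Open Scope classical_set_scope.
Local Open Scope ring_scope.

(* The vertex set is an arbitrary finite type V instead of {1, ..., m}, so that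
   m = #|V| and the powers X^m, (Z/2)^m and T^m are indexed by V. *)
Record simplicial_complex (V : finType) := SimplicialComplex {
  simplices :> {set {set V}};
  simplex0 : finset.set0 \in simplices;
  simplexS : forall I J : {set V},
    J \subset I -> I \in simplices -> J \in simplices }.

Section RealUniversalComplex.
Variable n : nat.

Definition primitive_vec := {v : 'rV['F_2]_n | v != 0}.

Definition part_of_basis (I : {set primitive_vec}) : bool :=
  [exists b : n.-tuple 'rV['F_2]_n,
    basis_of fullv b && [forall v in I, val v \in (b : seq _)]].

Definition universal_simplices : {set {set primitive_vec}} :=
  finset part_of_basis.

Fact universal_simplex0 : finset.set0 \in universal_simplices.
Proof.
rewrite finset.inE.
have dimE : \dim {:'rV['F_2]_n} = n by rewrite dimvf /dim /= mul1n.
apply/existsP; exists (tcast dimE (vbasis {:'rV['F_2]_n})).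
rewrite val_tcast vbasisP /=.
by apply/forall_inP => v; rewrite finset.inE.
Qed.

Fact universal_simplexS (I J : {set primitive_vec}) :
  J \subset I -> I \in universal_simplices -> J \in universal_simplices.
Proof.
move=> /fintype.subsetP sJI; rewrite !finset.inE => /existsP[b /andP[bb /forall_inP Ib]].
apply/existsP; exists b; rewrite bb /=.
by apply/forall_inP => v /sJI; exact: Ib.
Qed.

Definition real_universal_complex : simplicial_complex primitive_vec :=
  SimplicialComplex universal_simplex0 universal_simplexS.

End RealUniversalComplex.

Section PolyhedralProduct.
Variables (V : finType) (T : Type).

Definition pair_power (X A : set T) (I : {set V}) : set (V -> T) :=
  [set x | forall i, X (x i) /\ (i \notin I -> A (x i))].

Definition polyhedral_product (K : simplicial_complex V) (X A : set T) :
    set (V -> T) :=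
  \bigcup_(I in [set I : {set V} | I \in K]) pair_power X A I.

End PolyhedralProduct.

Definition acts_freely (G X : Type) (H : set G) (e : G) (act : G -> X -> X)
    (Z : set X) : Prop :=
  forall g x, H g -> Z x -> act g x = x -> g = e.

(* The greatest element of P; the default value 0 is taken only if P has no
   greatest element. *)
Definition max_nat (P : set nat) : nat :=
  xget 0%N [set k | P k /\ forall l, P l -> (l <= k)%N].

Section RealBuchstaber.
Variables (R : realType) (V : finType).

Definition D1 : set R := [set x | -1 <= x <= 1].
Definition S0 : set R := [set x | x = -1 \/ x = 1].

Definition real_moment_angle (K : simplicial_complex V) : set (V -> R) :=
  polyhedral_product K D1 S0.

(* {dffun V -> 'Z_2} rather than {ffun V -> 'Z_2}: only the former carries the
   direct product group structure. *)
Definition sign_action (g : {dffun V -> 'Z_2}) (x : V -> R) : V -> R :=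
  fun i => (-1) ^+ (g i : nat) * x i.

Definition real_buchstaber (K : simplicial_complex V) : nat :=
  max_nat [set k | exists H : {group {dffun V -> 'Z_2}},
    'r(H)%g = k /\ acts_freely [set g | g \in H] 1%g sign_action (real_moment_angle K)].

End RealBuchstaber.

Section Buchstaber.
Variable R : realType.

(* R[i]^o carries the topology of the complex modulus, and {ptws V -> R[i]^o}
   the product topology. *)
Local Notation C := (R[i]^o).

Definition D2 : set C := [set z | `|z| <= 1].
Definition S1 : set C := [set z | `|z| = 1].

Definition torus (V : finType) : set {ptws V -> C} :=
  [set t | forall i, S1 (t i)].
Arguments torus : clear implicits.

Definition tone (V : finType) : {ptws V -> C} := fun=> 1.
Arguments tone : clear implicits.
Definition tmul (V : finType) (t u : {ptws V -> C}) : {ptws V -> C} :=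
  fun i => t i * u i.
Definition tinv (V : finType) (t : {ptws V -> C}) : {ptws V -> C} :=
  fun i => (t i)^-1.

Definition closed_subgroup (V : finType) (G : set {ptws V -> C}) : Prop :=
  [/\ G `<=` torus V, closed G, G (tone V),
      forall t u, G t -> G u -> G (tmul t u) &
      forall t, G t -> G (tinv t)].

(* Isomorphism of topological groups between G and G', for the subspace
   topologies and coordinatewise multiplication. *)
Definition top_group_isom (V W : finType)
    (G : set {ptws V -> C}) (G' : set {ptws W -> C}) : Prop :=
  exists (phi : {ptws V -> C} -> {ptws W -> C})
         (psi : {ptws W -> C} -> {ptws V -> C}),
  [/\ (forall t, G t -> G' (phi t) /\ psi (phi t) = t),
      (forall u, G' u -> G (psi u) /\ phi (psi u) = u),
      (forall t t', G t -> G t' -> phi (tmul t t') = tmul (phi t) (phi t')),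
      {within G, continuous phi} &
      {within G', continuous psi}].

Definition toric_subgroup (V : finType) (r : nat) (G : set {ptws V -> C}) :
    Prop :=
  closed_subgroup G /\ top_group_isom (torus 'I_r) G.

Definition moment_angle (V : finType) (K : simplicial_complex V) : set {ptws V -> C} :=
  polyhedral_product K D2 S1.

Definition buchstaber (V : finType) (K : simplicial_complex V) : nat :=
  max_nat [set r | exists G : set {ptws V -> C},
    toric_subgroup r G /\ acts_freely G (tone V) (@tmul V) (moment_angle K)].

Definition Delta (V : finType) (K : simplicial_complex V) : int :=
  (real_buchstaber R K)%:Z - (buchstaber K)%:Z.

End Buchstaber.

Arguments torus R V _ : clear implicits.
Arguments tone R V _ : clear implicits.
Arguments moment_angle R {V} K _.
Arguments real_moment_angle R {V} K _.
Arguments buchstaber R {V} K.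
Arguments Delta R {V} K.

(* Main.v *)
(* If an integral matrix lambda with 7 rows and columns indexed by the nonzero
   vectors of F_2^5 sends every F_2-basis to a part of a basis of Z^7, then the
   kernel of the induced map T^31 -> T^7 acts freely on the moment-angle complex,
   and it is a torus of rank 24 when 7 columns of lambda form a basis of Z^7.  Up
   to a change of basis of Z^7, the matrix used here is
     lambda(v) = (0/1 lift of v, [|v| >= 2], [|v| >= 3]),
   where |v| is the Hamming weight: an odd 5x5 determinant with 0/1 entries is
   +-1, +-3 or +-5, and the two additional coordinates remove the 3- and
   5-torsion.  That all F_2-bases become unimodular is verified by an exhaustive
   computation.

   For the upper bound on the real invariant, a subgroup of (Z/2)^m acting freely
   meets trivially the sign changes supported on a simplex. *)
Require Import Defs.
From mathcomp Require Import all_boot all_order all_algebra.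
From mathcomp Require Import all_fingroup all_solvable complex.
From mathcomp Require Import all_classical all_reals all_analysis.

Set Implicit Arguments.
Unset Strict Implicit.
Unset Printing Implicit Defensive.

Import Order.TTheory GRing.Theory Num.Theory.
Import numFieldNormedType.Exports.

Local Open Scope classical_set_scope.
Local Open Scope ring_scope.

(** * Binary words, integer rows and the unimodularity test *)

Fixpoint pad_map2 (A : Type) (d : A) (f : A -> A -> A) (s t : seq A) : seq A :=
  match s, t with
  | a :: s', b :: t' => f a b :: pad_map2 d f s' t'
  | [::], _ => [seq f d b | b <- t]
  | _, [::] => [seq f a d | a <- s]
  end.

(** Missing entries read as [d], so lists of different lengths act as finitely supported sequences
    and [[::]] is the zero vector. *)
Lemma nth_pad_map2 (A : Type) (d : A) (f : A -> A -> A) s t i :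
  f d d = d -> nth d (pad_map2 d f s t) i = f (nth d s i) (nth d t i).
Proof.
move=> fdd; elim: s t i => [|a s IHs] [|b t] [|i] //=.
- by have [lt|le] := ltnP i (size t);
    [rewrite (nth_map d) | rewrite !nth_default ?size_map].
- by have [lt|le] := ltnP i (size s);
    [rewrite (nth_map d) | rewrite !nth_default ?size_map].
Qed.

Definition unit_entry (a : int) : bool := `|a|%N == 1%N.

Lemma unit_entry_sqr a : unit_entry a -> a * a = 1.
Proof. by case: a => [[|[|m]]|[|m]]. Qed.

(* The row [q] modulo the row [r], which must have an entry +-1. *)
Definition eliminate (r q : seq int) : seq int :=
  let p := find unit_entry r in
  let m := nth 0 q p * nth 0 r p in
  if m == 0 then q else pad_map2 0 (fun a b => a - m * b) q r.

Lemma nth_eliminate r q i (p := find unit_entry r) :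
  nth 0 (eliminate r q) i = nth 0 q i - nth 0 q p * nth 0 r p * nth 0 r i.
Proof.
rewrite /eliminate -/p; case: eqP => [->|_]; first by rewrite mul0r subr0.
by rewrite nth_pad_map2 // mulr0 subr0.
Qed.

Definition xor_word : seq bool -> seq bool -> seq bool := pad_map2 false addb.

Fixpoint words (n : nat) : seq (seq bool) :=
  if n is n'.+1
  then [seq false :: b | b <- words n'] ++ [seq true :: b | b <- words n']
  else [:: [::]].

Definition vec (n : nat) (b : seq bool) : 'rV['F_2]_n :=
  \row_i (nth false b i)%:R.

Lemma vec_xor n b c : vec n (xor_word b c) = vec n b + vec n c.
Proof.
apply/rowP => i; rewrite !mxE nth_pad_map2 //.
by case: (nth _ _ _); case: (nth _ _ _); apply/eqP.
Qed.

(* [st] lists the words still available, each with the image of its characteristic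
   vector modulo the words already chosen, and [span] lists the F_2-span of the
   chosen words.  The test runs through all choices of at most [k] further words
   that are F_2-independent together with the chosen ones.  It is sufficient but
   not necessary for unimodularity, since it insists on pivots +-1; the order of
   the words and of the coordinates matters for it to succeed. *)
Fixpoint all_unimodular (k : nat) (span : seq (seq bool))
    (st : seq (seq bool * seq int)) : bool :=
  if k isn't k'.+1 then true else
  (fix loop st := if st isn't (b, r) :: st' then true else
    [&& has unit_entry r,
        (let coset := [seq xor_word b s | s <- span] in
         all_unimodular k' (span ++ coset)
           [seq (w.1, eliminate r w.2) | w <- st' & w.1 \notin coset]) &
        loop st']) st.

(** * Soundness of the test *)

Section Soundness.
Variables (F : fieldType) (n : nat) (x : seq bool -> F).
Hypothesis x_neq0 : forall b, x b != 0.
Variable B : seq 'rV['F_2]_n.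
Hypothesis freeB : free B.
Hypothesis x_supp : forall b, vec n b \notin B -> x b = 1.

(* [x] is killed by the coordinates of the rows of [st], written multiplicatively. *)
Definition relations (st : seq (seq bool * seq int)) :=
  forall i, \prod_(w <- st) x w.1 ^ nth 0 w.2 i = 1.

Lemma prodfXz (I : Type) (s : seq I) (f : I -> F) (z : int) :
  \prod_(i <- s) f i ^ z = (\prod_(i <- s) f i) ^ z.
Proof. by rewrite (big_morph _ (fun u v => expfzMl u v z) (exp1rz F z)). Qed.

(** At the pivot [p] the entry [r_p] is +-1, so relation [p] expresses [x b] through the remaining
    values; substituting it removes the factor [x b ^ r_i] from relation [i]. *)
Lemma relations_eliminate b r st : has unit_entry r ->
  relations ((b, r) :: st) ->
  relations [seq (w.1, eliminate r w.2) | w <- st].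
Proof.
move=> /(nth_find 0) /unit_entry_sqr; set p := find _ _ => ur rel i.
rewrite big_map /=.
under eq_bigr => w _.
  rewrite nth_eliminate -/p expfzDr // -mulrA -mulrN -exprz_exp.
  over.
rewrite big_split /= prodfXz.
have split_rel j : \prod_(w <- st) x w.1 ^ nth 0 w.2 j = x b ^ - nth 0 r j.
  have := rel j; rewrite big_cons /= => /(canRL (mulKf _)) -> //.
    by rewrite mulr1 invr_expz.
  by rewrite expfz_neq0.
by rewrite !split_rel exprz_exp -expfzDr // mulNr mulrN opprK mulrA ur mul1r addNr.
Qed.

Lemma free_notin_span (ch : seq 'rV['F_2]_n) v :
  uniq ch -> {subset ch <= B} -> v \in B -> v \notin ch ->
  v \notin <<ch>>%VS.
Proof.
move=> uch sub vB vch.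
suff : free (v :: ch) by rewrite free_cons => /andP[].
have := filter_free (mem (v :: ch)) freeB.
rewrite (perm_free (Y := v :: ch)) //; apply: uniq_perm.
- by rewrite filter_uniq ?free_uniq.
- by rewrite /= vch.
move=> u; rewrite mem_filter andbC; case: (u \in B) / boolP => //= uB.
by apply/esym/negbTE; apply: contraNN uB; rewrite inE => /orP[/eqP->|/sub].
Qed.

(** Induction along the search, [ch] being the members of [B] chosen so far. A first word outside
    [B] has value 1 and drops out of the relations; one in [B] joins [ch] and is eliminated. *)
Lemma all_unimodularP k span st (ch : seq 'rV['F_2]_n) :
  all_unimodular k span st ->
  (forall s, s \in span -> vec n s \in <<ch>>%VS) ->
  uniq (ch ++ [seq vec n w.1 | w <- st]) -> {subset ch <= B} ->
  (size B <= size ch + k)%N ->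
  relations st ->
  forall w, w \in st -> x w.1 = 1.
Proof.
elim: k span st ch => [|k IHk] span st ch.
  (* With no choice left, [ch] is as long as [B], so a further word in [B] would be one too many. *)
  move=> _ _ uq subB szB _ w wst; apply: x_supp; apply/negP => wB.
  have : uniq (vec n w.1 :: ch).
    move: uq; rewrite cat_uniq => /and3P[uch /hasPn disj _].
    by rewrite /= uch andbT disj //; apply: (map_f (fun w => vec n w.1)).
  move=> /uniq_leq_size => /(_ B); rewrite /= => le; move: szB.
  by rewrite addn0 leqNgt le // => u; rewrite inE => /orP[/eqP->|/subB].
elim: st => [|[b r] st IHst] //.
rewrite [all_unimodular _ _ _]/=.
move=> /and3P[ur chk_in chk_out] spanP uq subB szB rel.
have [uch disj ust] : [/\ uniq ch,
    {in (b, r) :: st, forall w, vec n w.1 \notin ch} &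
    uniq [seq vec n w.1 | w <- (b, r) :: st]].
  move: uq; rewrite cat_uniq => /and3P[-> /hasPn disj ->]; split=> // w wst.
  by apply: disj; apply: (map_f (fun w => vec n w.1)).
have bch : vec n b \notin ch by apply: (disj (b, r)); rewrite mem_head.
have [bB|bB] := boolP (vec n b \in B); last first.
  move=> w; rewrite inE => /predU1P[->|wst]; first exact: x_supp.
  move: w wst; apply: IHst => //.
    by apply: subseq_uniq uq; apply: cat_subseq => //; apply: subseq_cons.
  by move=> i; have := rel i; rewrite big_cons /= x_supp // exp1rz mul1r.
set coset := [seq xor_word b s | s <- span] in chk_in.
pose ch' := vec n b :: ch.
have uch' : uniq ch' by rewrite /= bch.
have subB' : {subset ch' <= B} by move=> u; rewrite inE => /predU1P[->|/subB].
have chS : {subset <<ch>>%VS <= <<ch'>>%VS}.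
  by apply/subvP/sub_span => u uch1; rewrite inE uch1 orbT.
have cosetP s : s \in coset -> vec n s \in <<ch'>>%VS.
  case/mapP => c /spanP cch ->.
  by rewrite vec_xor memvD ?(chS (vec n c)) // memv_span ?mem_head.
have disj' w : w \in st -> vec n w.1 \notin ch'.
  move=> wst; rewrite inE negb_or disj ?inE ?wst ?orbT // andbT.
  move: ust => /= /andP[+ _]; apply: contra => /eqP <-.
  exact: (map_f (fun w => vec n w.1)).
(* A word in the coset lies in the span of [ch'], so freeness keeps it out of [B]; filtering it out
   only removes factors 1 from the relations. *)
have out1 w : w \in st -> w.1 \in coset -> x w.1 = 1.
  move=> wst wco; apply: x_supp; apply: contraL (cosetP _ wco) => wB.
  by apply: free_notin_span => //; apply: disj'.
have st1 w : w \in st -> x w.1 = 1.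
  move=> wst; have [wco|wco] := boolP (w.1 \in coset); first exact: out1.
  have -> : w.1 = (w.1, eliminate r w.2).1 by [].
  apply: (IHk _ _ ch' chk_in) => //.
  - move=> s; rewrite mem_cat => /orP[/spanP/chS|/cosetP] //.
  - rewrite -map_comp [uniq _]cat_uniq uch' /=; apply/andP; split.
      apply/hasPn => _ /mapP[u + ->]; rewrite mem_filter => /andP[_ ust1].
      exact: (disj' u ust1).
    move: ust => /= /andP[_]; apply: subseq_uniq.
    exact/map_subseq/filter_subseq.
  - by rewrite addSnnS.
  - apply: (relations_eliminate (b := b)) => // i.
    rewrite big_cons /=; have := rel i; rewrite big_cons /= => {2}<-.
    congr (_ * _); rewrite big_filter [RHS](bigID (fun w => w.1 \notin coset)) /=.
    rewrite [X in _ * X]big_seq_cond [X in _ * X]big1 ?mulr1 // => u /andP[ust1].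
    by rewrite negbK => uco; rewrite out1 // exp1rz.
  - by apply/mapP; exists w; rewrite // mem_filter wco.
move=> w; rewrite inE => /predU1P[->|] /=; last exact: st1.
(* All other values being 1, the relation at the pivot says that [x b] to the power +-1 is 1. *)
have := rel (find unit_entry r); rewrite big_cons big_seq big1 ?mulr1 /=; last first.
  by move=> u ust1; rewrite st1 // exp1rz.
have /unit_entry_sqr ss := nth_find 0 ur.
by move/(congr1 (fun y => y ^ nth 0 r (find unit_entry r))); rewrite exp1rz exprz_exp ss.
Qed.

End Soundness.

(** * Maxima, and the upper bound on the real invariant *)

Lemma max_nat_le (P : set nat) m :
  (forall k, P k -> (k <= m)%N) -> (max_nat P <= m)%N.
Proof. by move=> Pm; rewrite /max_nat; case: xgetP => // k _ [/Pm]. Qed.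

(** The bound [m] ensures that a greatest element exists, so the default 0 is not taken. *)
Lemma le_max_nat (P : set nat) k m :
  P k -> (forall l, P l -> (l <= m)%N) -> (k <= max_nat P)%N.
Proof.
move=> Pk Pm; have exP : exists i, `[< P i >] by exists k; apply/asboolP.
have ubP i : `[< P i >] -> (i <= m)%N by move/asboolP/Pm.
case: (ex_maxnP exP ubP) => i /asboolP Pi max_i.
rewrite /max_nat; case: xgetP => [j _ [_]|/(_ i) []]; first exact.
by split=> // l Pl; apply/max_i/asboolP.
Qed.

(* An element of [H] is determined by its coordinates outside of [I]: a sign change
   supported on [I] fixes the point whose coordinates are 0 on [I] and 1 elsewhere. *)
Lemma real_buchstaber_le (R : realType) (V : finType)
    (K : simplicial_complex V) (I : {set V}) :
  I \in K -> (real_buchstaber R K <= #|V| - #|I|)%N.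
Proof.
move=> IK; apply: max_nat_le => _ [H [<- freeH]].
pose supp (g : {dffun V -> 'Z_2}) : {set V} := [set i | g i != 0 & i \notin I]%SET.
have Z2_val (a b : 'Z_2) : (a != 0) = (b != 0) -> a = b.
  by case: a b => [[|[|//]] ?] [[|[|//]] ?] //= _; apply/val_inj.
have supp_inj : {in H &, injective supp}.
  move=> g h gH hH /setP eq_supp; apply/eqP; rewrite eq_mulgV1; apply/eqP.
  apply: (freeH _ (fun i => if i \in I then 0 else 1)).
  - by rewrite /= groupM ?groupV.
  - exists I => //= i; rewrite /Defs.D1 /Defs.S0 /=; case: ifP => _.
    + by split; rewrite ?lerN10 ?ler01.
    + by split; [rewrite lexx (le_trans (lerN10 _) ler01) | right].
  apply/funext => i; rewrite /sign_action; case: ifPn => [_|iI]; first by rewrite mulr0.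
  have := eq_supp i; rewrite !inE iI !andbT => /Z2_val eq_gh.
  by rewrite !ffunE eq_gh mulgV mulr1 expr0.
have cardH : (#|H| <= 2 ^ (#|V| - #|I|))%N.
  rewrite -[(#|V| - _)%N](_ : #|~: I|%SET = _) -?card_powerset; last first.
    by rewrite cardsCs finset.setCK.
  rewrite -(card_in_imset supp_inj).
  apply/subset_leq_card/fintype.subsetP => _ /imsetP[g _ ->].
  by rewrite inE; apply/fintype.subsetP => i; rewrite !inE => /andP[].
(* For a 2-group the rank is at most the base 2 logarithm of the order, which [cardH] bounds. *)
have pgroupH : (2.-group H)%g.
  apply: (pgroupS (G := [set: {dffun V -> 'Z_2}]%G)); first exact: finset.subsetT.
  by rewrite /pgroup cardsT card_ffun card_ord pnatX pnat_id.
rewrite (rank_pgroup pgroupH) (leq_trans (p_rank_le_logn _ _)) //.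
by rewrite -(leq_exp2l (m := 2)) // (leq_trans _ cardH) // -p_part part_pnat_id.
Qed.

(** * Ranks of toric subgroups *)

Section ToricRank.
Variable R : realType.
Local Notation C := (R[i]^o).

(* A torus of rank [r] contains 2^r elements of order at most 2. *)
Lemma toric_subgroup_rank_le (V : finType) r (G : set {ptws V -> C}) :
  toric_subgroup r G -> (r <= #|V|)%N.
Proof.
case=> -[GT _ _ _ _] [phi [psi [phiP _ phiM _ _]]].
pose sg (f : {ffun 'I_r -> bool}) : {ptws 'I_r -> C} := fun i => (-1) ^+ f i.
have sgT f : torus R 'I_r (sg f).
  by move=> i; rewrite /Defs.S1 /= normrX normrN1 expr1n.
have sg2 f : tmul (sg f) (sg f) = tone R 'I_r.
  by apply/funext => i; rewrite /tmul /sg -expr2 sqrr_sign.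
have oneT : torus R 'I_r (tone R 'I_r).
  by move=> i; rewrite /Defs.S1 /= normr1.
have phi1 v : phi (tone R 'I_r) v = 1.
  have := phiM _ _ oneT oneT.
  have -> : tmul (tone R 'I_r) (tone R 'I_r) = tone R 'I_r.
    by apply/funext => i; rewrite /tmul /tone mulr1.
  move=> /(congr1 (fun t => t v)); rewrite /tmul => phi1E.
  have : phi (tone R 'I_r) v != 0.
    by rewrite -normr_eq0 (GT _ (phiP _ oneT).1 v) oner_eq0.
  by move=> nz; apply/(mulfI nz); rewrite mulr1 -phi1E.
(* [phi (sg f)] squares to 1, so its coordinates are +-1 and [sgn f] determines it; injectivity of
   [sgn] gives [2 ^ r <= 2 ^ #|V|]. *)
pose sgn f : {ffun V -> bool} := [ffun v => phi (sg f) v == 1].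
have sgn_inj : injective sgn.
  move=> f g /ffunP eq_sgn.
  have phi_sgn h v : phi (sg h) v = if sgn h v then 1 else - 1.
    rewrite ffunE; case: eqP => // /eqP /negbTE n1.
    have := phiM _ _ (sgT h) (sgT h); rewrite sg2 => /(congr1 (fun t => t v)).
    rewrite phi1 /tmul => /esym/eqP; rewrite -expr2 sqrf_eq1 n1 => /eqP -> //.
  have : sg f = sg g.
    rewrite -(phiP _ (sgT f)).2 -(phiP _ (sgT g)).2; congr psi.
    by apply/funext => v; rewrite !phi_sgn eq_sgn.
  move=> eq_sg; apply/ffunP => i; have /eqP := congr1 (fun t => t i) eq_sg.
  by rewrite /sg (inj_eq (@signr_inj _)) => /eqP.
have := leq_card _ sgn_inj; rewrite !card_ffun card_bool card_ord.
by rewrite leq_exp2l.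
Qed.

End ToricRank.

(** * Monomial maps of tori and their kernels *)

Lemma cvg_exprz (K : numFieldType) (T : Type) (F : set_system T) (f : T -> K^o)
    (a : K^o) (n : int) :
  Filter F -> a != 0 -> f @ F --> a -> (fun y => f y ^ n : K^o) @ F --> (a ^ n : K^o).
Proof.
move=> FF a0 fa.
have cvgX m : (fun y => f y ^+ m : K^o) @ F --> (a ^+ m : K^o).
  elim: m => [|m IHm].
    by rewrite expr0; under eq_cvg do rewrite expr0; exact: cvg_cst.
  by rewrite exprS; under eq_cvg do rewrite exprS; exact: cvgM.
case: n => n; first exact: cvgX.
by apply: cvgV (cvgX _); rewrite expf_neq0.
Qed.

Lemma normrXz (K : numFieldType) (a : K) (n : int) : `|a ^ n| = `|a| ^ n.
Proof. by case: n => n; rewrite ?NegzE -?exprnN -?exprnP ?normfV normrX. Qed.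

Lemma closure_eq_cst (T U : topologicalType) (A : set T) (f : T -> U) (t : T) (c : U) :
  hausdorff_space U -> {for t, continuous f} -> {in A, forall s, f s = c} ->
  closure A t -> f t = c.
Proof.
move=> hU ft fc clAt; apply: contrapT => ftc.
have nbhs_ft : nbhs (f t) (~` [set c]).
  apply: open_nbhs_nbhs; split=> //; apply: closed_openC.
  exact/accessible_closed_set1/hausdorff_accessible.
have [s [As]] := clAt _ (ft _ nbhs_ft).
by apply; rewrite /= fc //; exact/mem_set.
Qed.

Lemma continuous_prod (T : topologicalType) (I : eqType)
    (K : I -> topologicalType) (f : T -> prod_topology K) s :
  (forall i, {for s, continuous (fun t => f t i)}) -> {for s, continuous f}.
Proof.
move=> cf; apply/cvg_sup => v N [U] [[W oW <-] Ofs ON].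
by apply: filterS ON _; apply: (cf v); apply: open_nbhs_nbhs; split.
Qed.

Section Torus.
Variable R : realType.
Local Notation C := (R[i]^o).

Lemma torus_neq0 (V : finType) (t : {ptws V -> C}) v : torus R V t -> t v != 0.
Proof. by move=> tT; rewrite -normr_eq0 (tT v) oner_eq0. Qed.

(** On tori, this is the homomorphism with exponent matrix [A]. *)
Definition monomial_map (W V : finType) (A : V -> W -> int)
    (s : {ptws W -> C}) : {ptws V -> C} := fun v => \prod_w s w ^ A v w.

Lemma monomial_map_torus (W V : finType) (A : V -> W -> int) s :
  torus R W s -> torus R V (monomial_map A s).
Proof.
move=> sT v; rewrite /Defs.S1 /= /monomial_map.
rewrite (big_morph _ (@normrM _) (@normr1 _)) big1 // => w _.
by rewrite normrXz (sT w) exp1rz.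
Qed.

Lemma monomial_mapM (W V : finType) (A : V -> W -> int) s t :
  monomial_map A (tmul s t) = tmul (monomial_map A s) (monomial_map A t).
Proof.
apply/funext => v; rewrite /tmul /monomial_map -big_split /=.
by apply: eq_bigr => w _; rewrite expfzMl.
Qed.

Lemma monomial_mapV (W V : finType) (A : V -> W -> int) s :
  monomial_map A (tinv s) = tinv (monomial_map A s).
Proof.
apply/funext => v; rewrite /tinv /monomial_map.
rewrite (big_morph _ (@invfM _) (@invr1 _)).
by apply: eq_bigr => w _; rewrite exprz_inv invr_expz.
Qed.

Lemma continuous_monomial_map (W V : finType) (A : V -> W -> int) s :
  torus R W s -> {for s, continuous (monomial_map A)}.
Proof.
move=> sT; refine (@continuous_prod {ptws W -> C} V (fun=> C) (monomial_map A) s _) => v.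
apply: (@cvg_big C W *%R 1 xpredT (@mul_continuous _ ) _ (nbhs s)
  (index_enum W) (fun w (s : {ptws W -> C}) => s w ^ A v w)) => w _.
apply: cvg_exprz; first exact: torus_neq0.
exact: (@proj_continuous W (fun=> C) w s).
Qed.

Lemma closure_torus (V : finType) (G : set {ptws V -> C}) :
  G `<=` torus R V -> closure G `<=` torus R V.
Proof.
move=> GT t clGt v.
refine (@closure_eq_cst {ptws V -> C} (R[i] : numFieldType) G
  (fun s => `|s v|) t 1 _ _ _ clGt).
- exact: (@norm_hausdorff _ (R[i] : numFieldType)^o).
- refine (@continuous_comp {ptws V -> C} C (R[i] : numFieldType)
    (fun s => s v) Num.norm t _ _).
    exact: (@proj_continuous V (fun=> C) v t).
  exact: (@norm_continuous (R[i] : numFieldType) C (t v)).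
- by move=> s /set_mem /GT /(_ v).
Qed.

Definition torus_kernel (V W : finType) (lam : W -> V -> int) : set {ptws V -> C} :=
  [set t | torus R V t /\ monomial_map lam t = tone R W].

Lemma closed_subgroup_kernel (V W : finType) (lam : W -> V -> int) :
  closed_subgroup (torus_kernel lam).
Proof.
have tone_tmul : tmul (tone R W) (tone R W) = tone R W.
  by apply/funext => v; rewrite /tmul /tone mulr1.
split.
- by move=> t [].
(* Continuity of [monomial_map] is available on the torus, where no coordinate vanishes, so the
   limit point is first placed there. *)
- move=> t clt; have tT : torus R V t by apply: closure_torus clt => s [].
  split=> //; refine (@closure_eq_cst {ptws V -> C} {ptws W -> C} _
    (monomial_map lam) t (tone R W) _ _ _ clt).
  + exact: (@hausdorff_product W (fun=> C) (fun=> @norm_hausdorff _ C)).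
  + exact: (@continuous_monomial_map V W lam t tT).
  + by move=> s /set_mem [].
- split; first by move=> v; rewrite /Defs.S1 /= normr1.
  by apply/funext => w; rewrite /monomial_map big1 // => v _; rewrite exp1rz.
- move=> t u [tT tk] [uT uk]; split; last by rewrite monomial_mapM tk uk.
  by move=> v; rewrite /Defs.S1 /tmul /= normrM (tT v) (uT v) mulr1.
- move=> t [tT tk]; split.
    by move=> v; rewrite /Defs.S1 /tinv /= normfV (tT v) invr1.
  by rewrite monomial_mapV tk; apply/funext => w; rewrite /tinv /tone invr1.
Qed.

(* The coordinates outside of [b] are free, and determine those in [b]. *)
Lemma toric_kernel (V W : finType) (lam : W -> V -> int) (b : W -> V) :
  (forall i j, lam i (b j) = (i == j)%:Z) ->
  toric_subgroup (#|V| - #|W|) (torus_kernel lam).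
Proof.
move=> lamb; split; first exact: closed_subgroup_kernel.
have b_inj : injective b.
  by move=> i j ij; have := lamb i j; rewrite -ij lamb eqxx; case: eqP.
set r := (_ - _)%N; have -> : r = #|[predC codom b]|.
  by rewrite /r -(cardC (mem (codom b))) (card_codom b_inj) addKn.
pose iota (i : 'I_#|[predC codom b]|) : V := enum_val i.
(* Column [b j] of [lam] is a unit vector, so equation [j] can be solved for the coordinate [b j],
   with exponents [- lam j] on the free coordinates; the other rows copy a free coordinate. *)
pose A (v : V) (i : 'I_#|[predC codom b]|) : int :=
  if [pick j | b j == v] is Some j then - lam j (iota i) else (iota i == v)%:Z.
have A_iota i i' : A (iota i) i' = (i' == i)%:Z.
  rewrite /A; case: pickP => [j /eqP bj|_]; last by rewrite (inj_eq enum_val_inj).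
  by have := enum_valP i; rewrite -[enum_val i]/(iota i) -bj inE /= codom_f.
have A_b j i : A (b j) i = - lam j (iota i).
  rewrite /A; case: pickP => [j' /eqP/b_inj -> //|/(_ j)]; by rewrite eqxx.
pose psi (t : {ptws V -> C}) : {ptws 'I_#|[predC codom b]| -> C} := fun i => t (iota i).
have prod_split (t : {ptws V -> C}) j : torus R V t ->
    \prod_v t v ^ lam j v = t (b j) * \prod_i t (iota i) ^ lam j (iota i).
  move=> tT; rewrite (bigID (mem (codom b))) /=; congr (_ * _); last first.
    by rewrite -(big_enum_val (fun v => t v ^ lam j v)).
  rewrite -big_uniq ?codomE ?(map_inj_uniq b_inj) ?enum_uniq // big_map big_enum /=.
  rewrite (bigD1 j) //= lamb eqxx expr1z big1 ?mulr1 // => i ij.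
  by rewrite lamb eq_sym (negbTE ij).
have mapK s : torus R _ s ->
    torus_kernel lam (monomial_map A s) /\ psi (monomial_map A s) = s.
  move=> sT; have monT := monomial_map_torus A sT.
  have mon_iota i : monomial_map A s (iota i) = s i.
    rewrite /monomial_map (bigD1 i) //= A_iota eqxx expr1z big1 ?mulr1 // => i' ii'.
    by rewrite A_iota (negbTE ii').
  split; last by apply/funext => i; exact: mon_iota.
  split=> //; apply/funext => j; rewrite {1}/monomial_map prod_split //.
  under [X in _ * X]eq_bigr do rewrite mon_iota.
  rewrite {1}/monomial_map -big_split big1 //= => i _.
  by rewrite A_b -expfzDr ?torus_neq0 // addNr.
have psiK t : torus_kernel lam t -> torus R _ (psi t) /\ monomial_map A (psi t) = t.
  move=> [tT tk]; split; first by move=> i; exact: tT.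
  apply/funext => v; rewrite /monomial_map.
  have [/codomP[j ->]|vb] := boolP (v \in codom b).
    have := congr1 (fun u => u j) tk; rewrite {1}/monomial_map prod_split // => tbj.
    under eq_bigr do rewrite A_b -invr_expz.
    rewrite -(big_morph _ (@invfM _) (@invr1 _)).
    have nz : \prod_i t (iota i) ^ lam j (iota i) != 0.
      by apply/prodf_neq0 => i _; rewrite expfz_neq0 // torus_neq0.
    by apply: (mulIf nz); rewrite tbj mulVf.
  have [i ->] : exists i, v = iota i.
    have vb' : v \in [predC codom b] by [].
    by exists (enum_rank_in vb' v); rewrite /iota enum_rankK_in.
  rewrite (bigD1 i) //= A_iota eqxx expr1z big1 ?mulr1 // => i' ii'.
  by rewrite A_iota (negbTE ii').
exists (monomial_map A), psi; split=> //.
- by move=> s u _ _; rewrite monomial_mapM.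
- apply: continuous_in_subspaceT => s /set_mem sT.
  exact: (@continuous_monomial_map _ _ A s sT).
- apply: continuous_subspaceT => t.
  refine (@continuous_prod {ptws V -> C} _ (fun=> C) psi t _) => i.
  exact: (@proj_continuous V (fun=> C) (iota i) t).
Qed.

End Torus.

Arguments torus_kernel R {V W} lam _.

(** * Words as vertices of the universal complex, and the matrix *)

Section UniversalComplex.

Definition bits (n : nat) (u : 'rV['F_2]_n) : seq bool :=
  [seq u 0 i != 0 | i <- enum 'I_n].

Lemma bitsK n : cancel (@bits n) (vec n).
Proof.
move=> u; apply/rowP => i; rewrite mxE /bits (nth_map i) ?size_enum_ord //.
rewrite nth_ord_enum; case: (u 0 i) => -[|[|//]] ltm; exact/val_inj.
Qed.

Lemma vecK n b : size b = n -> bits (vec n b) = b.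
Proof.
move=> szb; apply: (@eq_from_nth _ false); rewrite size_map size_enum_ord // => i ltin.
rewrite (nth_map (Ordinal ltin)) ?size_enum_ord // mxE nth_enum_ord //.
by case: nth.
Qed.

Lemma has_bits n (u : 'rV['F_2]_n) : has id (bits u) = (u != 0).
Proof.
rewrite has_map; apply/hasP/idP => [[i _ /=]|/rV0Pn[i ui]]; last first.
  by exists i; rewrite ?mem_enum.
by apply: contraNneq => ->; rewrite mxE.
Qed.

Lemma mem_words n b : (b \in words n) = (size b == n).
Proof.
elim: n b => [|n IHn] [|a b] //=.
  by rewrite mem_cat; apply/negbTE/norP; split; apply/mapP => -[].
rewrite mem_cat eqSS -IHn; apply/orP/idP => [[]/mapP[c cn [_ ->]] //|bn].
by case: a; [right|left]; apply: map_f.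
Qed.

Lemma words_uniq n : uniq (words n).
Proof.
elim: n => //= n IHn.
rewrite cat_uniq !map_inj_uniq ?IHn; try by move=> b c [].
by rewrite andbT; apply/hasPn => _ /mapP[c _ ->]; apply/mapP => -[].
Qed.

Definition primitive_words n := [seq b <- words n | has id b].

(** Turns products over the vertices into products over the list on which the test runs. *)
Lemma perm_primitive_words n :
  perm_eq [seq bits (val v) | v <- enum {: primitive_vec n}] (primitive_words n).
Proof.
apply: uniq_perm; rewrite ?filter_uniq ?words_uniq //.
  rewrite map_inj_uniq ?enum_uniq // => u v /(can_inj (@bitsK n)); exact: val_inj.
move=> b; rewrite mem_filter mem_words; apply/mapP/andP.
  by case=> v _ ->; rewrite has_bits (valP v) size_map size_enum_ord.
case=> hasb /eqP szb; rewrite -(vecK szb) has_bits in hasb.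
by exists (Sub (vec n b) hasb); rewrite ?mem_enum ?SubK ?vecK.
Qed.

(** Any F_2-basis gives a simplex with [n] vertices, to which the general bound applies. *)
Lemma real_buchstaber_universal_le (R : realType) n :
  (real_buchstaber R (real_universal_complex n) <= #|{: primitive_vec n}| - n)%N.
Proof.
have dimE : \dim {:'rV['F_2]_n} = n by rewrite dimvf /dim /= mul1n.
pose b : n.-tuple 'rV['F_2]_n := tcast dimE (vbasis {:'rV['F_2]_n}).
have bb : basis_of fullv b by rewrite /b val_tcast vbasisP.
pose I := [set v : primitive_vec n | val v \in (b : seq _)]%SET.
have cardI : #|I| = n.
  rewrite -(card_imset _ val_inj) -[RHS](size_tuple b).
  rewrite -(card_uniqP (free_uniq (basis_free bb))).
  apply: eq_card => u; apply/imsetP/idP => [[v + ->]|ub]; first by rewrite inE.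
  have u0 : u != 0 := free_not0 (basis_free bb) ub.
  by exists (Sub u u0); rewrite ?inE ?SubK.
rewrite -[X in (_ <= _ - X)%N]cardI; apply: real_buchstaber_le.
rewrite inE; apply/existsP; exists b; rewrite bb /=.
by apply/forall_inP => v; rewrite inE.
Qed.

(* The vector lambda(v) in the basis of Z^7 formed by the images of [base_words];
   its first two coordinates are the indicators of weight 2 and weight >= 3. *)
Definition char_row (b : seq bool) : seq int :=
  let w := count id b in
  let base := if w == 2 then [:: 1; 1] else if (2 < w)%N then nseq 5 1 else [::] in
  [:: ((w == 2) : nat)%:Z, ((2 < w)%N : nat)%:Z &
      pad_map2 0 (fun a c => a - c) [seq (a : nat)%:Z | a : bool <- b] base].

(** One word of weight 2, the word of weight 5 and the five of weight 1, ordered so that [char_row]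
    sends the j-th to the j-th unit vector. *)
Definition base_words : seq (seq bool) :=
  [:: [:: true; true; false; false; false], nseq 5 true
    & [seq [seq i == j | i <- iota 0 5] | j <- iota 0 5]].

(** Depth 5 is the size of an F_2-basis; the initial span consists of the zero word [[::]]. *)
Lemma char_rows_unimodular :
  all_unimodular 5 [:: [::]] [seq (b, char_row b) | b <- primitive_words 5].
Proof. by vm_compute. Qed.

Lemma size_char_row b : size b = 5 -> size (char_row b) = 7.
Proof.
move=> szb; suff : all (fun b => size (char_row b) == 7) (words 5).
  by move/allP/(_ b); rewrite mem_words szb => /(_ isT)/eqP.
by vm_compute.
Qed.

Definition char_map (j : 'I_7) (v : primitive_vec 5) : int :=
  nth 0 (char_row (bits (val v))) j.

(** These seven vertices carry the coordinates that [toric_kernel] solves for, which leaves rank 31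
    - 7 = 24. *)
Lemma char_map_base : exists b : 'I_7 -> primitive_vec 5,
  forall i j, char_map i (b j) = (i == j)%:Z.
Proof.
have base_ok (j : 'I_7) :
    (size (nth [::] base_words j) == 5) && has id (nth [::] base_words j).
  by case: j => -[|[|[|[|[|[|[|//]]]]]]].
have base_neq0 (j : 'I_7) : vec 5 (nth [::] base_words j) != 0.
  by have /andP[/eqP sz] := base_ok j; rewrite -{1}(vecK sz) has_bits.
exists (fun j => exist (fun u : 'rV_5 => u != 0) _ (base_neq0 j)) => i j.
rewrite /char_map /=.
have /andP[/eqP sz _] := base_ok j; rewrite vecK //.
case: i j {sz} => -[|[|[|[|[|[|[|//]]]]]]] ? [[|[|[|[|[|[|[|//]]]]]]] ?]; by vm_compute.
Qed.

(** * Freeness of the kernel action *)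

Section Free.
Variable R : realType.
Local Notation C := (R[i]^o).

(** An element fixing a point over the simplex [I] is 1 outside [I], hence outside an F_2-basis [B]
    containing [I]. The kernel equations are the relations of the test, which force the remaining
    coordinates to be 1. *)
Lemma char_kernel_free :
  acts_freely (torus_kernel R char_map) (tone R (primitive_vec 5)) (@tmul R _)
    (moment_angle R (real_universal_complex 5)).
Proof.
move=> g z [gT gk] [I IK zI] gz.
have gI v : v \notin I -> g v = 1.
  move=> vI; have [_ /(_ vI) zv] := zI v.
  have nz : z v != 0 by rewrite -normr_eq0 (zv : `|z v| = 1) oner_eq0.
  by apply: (mulIf nz); rewrite mul1r; have := congr1 (fun t => t v) gz.
move: IK; rewrite /= inE => /existsP[B /andP[bB /forall_inP IB]].
(* The zero vector is no vertex; the value 1 given to it is nonzero and agrees with the values off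
   [B]. *)
pose x (b : seq bool) : C :=
  if insub (vec 5 b) is Some v then g v else 1.
have x_bits v : x (bits (val v)) = g v by rewrite /x bitsK valK.
have perm_w := perm_primitive_words 5.
have x1 := @all_unimodularP C 5 x _ B (basis_free bB) _ 5 _ _ [::]
  char_rows_unimodular.
apply/funext => v; rewrite -x_bits.
have -> : bits (val v) = (bits (val v), char_row (bits (val v))).1 by [].
apply: x1 => //.
- move=> b; rewrite /x; case: insub => [u|]; last exact: oner_neq0.
  exact: torus_neq0.
- move=> b; rewrite /x; case: insubP => // u _ <- uB; apply: gI.
  by apply: contra uB => /IB.
- move=> s; rewrite inE => /eqP ->; suff -> : vec 5 [::] = 0 by exact: mem0v.
  by apply/rowP => i; rewrite !mxE nth_nil.
- rewrite cat0s -map_comp map_inj_in_uniq ?filter_uniq ?words_uniq // => b c.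
  rewrite !mem_filter !mem_words => /andP[_ /eqP sb] /andP[_ /eqP sc].
  by move=> /= /(congr1 (@bits 5)); rewrite !vecK.
- by rewrite size_tuple.
- move=> i; rewrite big_map /= -(perm_big _ perm_w) big_map big_enum /=.
  under eq_bigr do rewrite x_bits.
  (* Relations are required at every index; from 7 on all exponents are the default 0. *)
  have [lti|lei] := ltnP i 7.
    by have := congr1 (fun t => t (Ordinal lti)) gk.
  rewrite big1 // => u _; rewrite nth_default // (leq_trans _ lei) //.
  by rewrite size_char_row // size_map size_enum_ord.
- apply/mapP; exists (bits (val v)) => //.
  by rewrite -(perm_mem perm_w); apply: map_f; rewrite mem_enum.
Qed.

End Free.
End UniversalComplex.

Theorem theorem1p1 (R : realType) :
  Delta R (real_universal_complex 5) <= 2 /\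
  (24 <= buchstaber R (real_universal_complex 5))%N.
Proof.
have card_V : #|{: primitive_vec 5}| = 31.
  rewrite cardE -(size_map (fun v => bits (val v))).
  by rewrite (perm_size (perm_primitive_words 5)).
have real_le := real_buchstaber_universal_le R 5.
have le_buch : (24 <= buchstaber R (real_universal_complex 5))%N.
  (* The number of vertices bounds the rank of every toric subgroup. *)
  apply: (@le_max_nat _ _ 31).
    have [b char_b] := char_map_base; have := @toric_kernel R _ _ _ _ char_b.
    rewrite card_V card_ord => tor; exists (torus_kernel R char_map); split=> //.
    exact: char_kernel_free.
  by move=> l [G [/toric_subgroup_rank_le + _]]; rewrite card_V.
split=> //; rewrite /Delta lerBlDr -PoszD lez_nat.
(* The real invariant is at most 31 - 5 = 26 = 2 + 24. *)
by rewrite card_V in real_le; apply: leq_trans real_le _; rewrite (leq_add2l 2 24).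
Qed.
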